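(* For all positive integers $d,n$, $$|\mathfrak{Bl}_{d,n}|=d^{n}\sum_{k=1}^{n}\chi_k^{(n)}(1+d)^k.$$
   Context: TL-diagrams: place top points $1,\dots,n$ and bottom points $1',\dots,n'$ on the two boundary lines of the strip $\mathbb{R}\times[0,1]$; a TL-diagram on $n$ points is a non-crossing perfect matching of these $2n$ points drawn as $n$ disjoint arcs in the strip, up to isotopy. The left side is the unbounded complementary region containing points $(x,1/2)$ with $x$ very negative; an arc is exposed to the left side if it lies on the boundary of that region. For $k\in[1,n]$, $\chi_k^{(n)}$ is the number of TL-diagrams on $n$ points with exactly $k$ arcs exposed to the left side. A blobbed TL-diagram is a TL-diagram in which some left-exposed arcs carry one blob each. Abacus blob monoid $\mathfrak{Bl}_{d,n}$: an element is a blobbed TL-diagram together with a label in $\mathbb{Z}/d\mathbb{Z}$ on each component, where an unblobbed arc is one component and a blobbed arc is split by its blob into two components, each containing one endpoint; two elements are equal iff their diagrams and all labels agree. Product $X\cdot Y$: place $X$ above $Y$, identify the bottom points of $X$ with the top points of $Y$; delete closed loops with their decorations; each resulting arc is a chain of pieces; if no piece has a blob, the arc is unblobbed with label the sum of all labels along it; otherwise it carries exactly one blob and each of its two components gets the sum of labels met travelling from the corresponding endpoint up to the first blob (labels between blobs are discarded). *)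

(* Defs.v *)
From mathcomp Require Import all_boot.

Set Implicit Arguments.
Unset Strict Implicit.
Unset Printing Implicit Defensive.

(* [inl i] is the top point i+1 and [inr i] is the bottom point (i+1)'. *)
Definition point (n : nat) : finType := ('I_n + 'I_n)%type.

(* The strip is a disc whose boundary, read clockwise from its left end, meets
   the points in the order 1, ..., n, n', ..., 1'; [pos] is the rank in this
   order. *)
Definition pos (n : nat) (p : point n) : nat :=
  match p with
  | inl i => i
  | inr i => n + rev_ord i
  end.

Definition crossing (n : nat) (a b : {set point n}) : bool :=
  [exists p in a, exists q in a, exists r in b, exists s in b,
    [&& pos p < pos r, pos r < pos q & pos q < pos s]].

(* Pairwise disjoint arcs in a disc are determined up to isotopy by the pairs
   of boundary points they join, so a diagram is the set of these pairs. *)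
Definition is_tl (n : nat) (M : {set {set point n}}) : bool :=
  [&& partition M [set: point n],
      [forall a in M, #|a| == 2]
    & [forall a in M, forall b in M, ~~ crossing a b]].

Definition tl_diagram (n : nat) : finType :=
  {M : {set {set point n}} | is_tl M}.

(* The 2n points cut the boundary of the disc into intervals: interval [g] lies
   just before the point of position [g] and just after the one of position
   [g - 1]; intervals 0 and 2n both reach the left end. An arc separates
   interval [g] from the left end iff [g] lies between its two endpoints. *)
Definition separates_left (n : nat) (a : {set point n}) (g : nat) : bool :=
  [exists p in a, exists q in a, pos p < g <= pos q].

(* Interval [g] lies on the boundary of the left side of the diagram [M]. *)
Definition in_left_side (n : nat) (M : {set {set point n}}) (g : nat) : bool :=
  [forall a in M, ~~ separates_left a g].

(* The two regions bordered by an arc are those containing the two boundary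
   intervals adjacent to an endpoint of the arc. *)
Definition left_exposed (n : nat) (D : tl_diagram n) : {set {set point n}} :=
  [set a in val D | [exists p in a, in_left_side (val D) (pos p)
                                 || in_left_side (val D) (pos p).+1]].

Definition chi (n k : nat) : nat :=
  #|[set D : tl_diagram n | #|left_exposed D| == k]|.

(* A diagram together with the set of its blobbed arcs. *)
Definition blobbed_tl_diagram (n : nat) : finType :=
  {X : tl_diagram n * {set {set point n}} | X.2 \subset left_exposed X.1}.

(* A component is represented by the set of endpoints it contains. *)
Definition components (n : nat) (X : blobbed_tl_diagram n) :
    {set {set point n}} :=
  let: (D, B) := val X in
  (val D :\: B) :|: [set [set p] | p in cover B].

(* The residues modulo [d], for [0 < d]; note that ['Z_1] would have two
   elements. *)
Definition residue (d : nat) : finType := 'I_d.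

(* The underlying set of the abacus blob monoid. *)
Definition abacus_blob (d n : nat) : finType :=
  {X : blobbed_tl_diagram n &
     {ffun {c : {set point n} | c \in components X} -> residue d}}.

(* Main.v *)
(* A diagram with blob set B has n - #|B| unblobbed arcs and 2 #|B| halves of
   blobbed arcs, hence d ^ (n + #|B|) labellings. Summing over the subsets B of
   the set of exposed arcs gives d ^ n * (1 + d) ^ k for a diagram with k exposed
   arcs, and k > 0 because the arc through the leftmost top point is exposed. *)
Require Import Defs.
From mathcomp Require Import all_boot.

Set Implicit Arguments.
Unset Strict Implicit.
Unset Printing Implicit Defensive.

(** The binomial theorem, with ['C(#|A|, k)] read as the number of k-element subsets of [A]. *)
Lemma sum_subset_expn (T : finType) (A : {set T}) (d : nat) :
  \sum_(B : {set T} | B \subset A) d ^ #|B| = (1 + d) ^ #|A|.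
Proof.
rewrite expnDn.
(* [inord] never takes its default value here, since a subset of [A] has at most [#|A|] elements. *)
rewrite (partition_big (fun B : {set T} => inord #|B| : 'I_(#|A|).+1) predT) //=.
apply: eq_bigr => k _.
rewrite exp1n mul1n -cards_draws -sum_nat_const.
apply: eq_big => B.
  rewrite inE; case: (boolP (B \subset A)) => //= sBA.
  by rewrite -val_eqE /= inordK // ltnS subset_leq_card.
by case/andP=> sBA /eqP <-; rewrite inordK // ltnS subset_leq_card.
Qed.

Section Diagram.
Variable n : nat.
Implicit Type D : tl_diagram n.

Lemma tl_partition D : partition (val D) [set: point n].
Proof. by case/and3P: (valP D). Qed.

Lemma card_arc D a : a \in val D -> #|a| = 2.
Proof. by case/and3P: (valP D) => _ /forall_inP D2 _ /D2/eqP. Qed.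

(** The arcs partition the 2n points into pairs. *)
Lemma card_tl_diagram D : #|val D| = n.
Proof.
apply/eqP; rewrite -(eqn_pmul2r (isT : 0 < 2)).
rewrite -(card_uniform_partition (@card_arc D) (tl_partition D)).
by rewrite cardsT card_sum card_ord muln2 addnn.
Qed.

Lemma card_cover_arcs D (B : {set {set point n}}) :
  B \subset val D -> #|cover B| = #|B| * 2.
Proof.
move=> /subsetP sBD; apply: card_uniform_partition => [a /sBD /card_arc //|].
case/and3P: (tl_partition D) => _ tD D0; apply/and3P; split=> //.
  by apply: trivIsetS tD; apply/subsetP.
by apply: contra D0 => /sBD.
Qed.

Lemma left_exposed_sub D : left_exposed D \subset val D.
Proof. by apply/subsetP => a; rewrite inE => /andP[]. Qed.

Lemma card_components (X : blobbed_tl_diagram n) :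
  #|components X| = n + #|(val X).2|.
Proof.
case: X => -[D B] /= sB; rewrite /components /=.
have sBD := subset_trans sB (left_exposed_sub D).
(* Unblobbed arcs have two endpoints and halves of blobbed arcs only one, so no component is of both
   kinds. *)
rewrite cardsU (_ : _ :&: _ = set0); last first.
  apply/setP=> a; rewrite !inE; apply/negP=> /andP[/andP[_ /card_arc]].
  by move=> a2 /imsetP[p _ a1]; rewrite a1 cards1 in a2.
rewrite cards0 subn0 (card_imset _ (@set1_inj _)) (card_cover_arcs sBD).
rewrite cardsD (setIidPr sBD) card_tl_diagram muln2 -addnn addnA subnK //.
(* The truncated subtraction [n - #|B|] is harmless because [B] consists of arcs of [D]. *)
by rewrite -[leqRHS](card_tl_diagram D) subset_leq_card.
Qed.

Lemma left_exposed_gt0 D : 0 < n -> 0 < #|left_exposed D|.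
Proof.
move=> n_gt0; pose p : point n := inl (Ordinal n_gt0).
have pD : p \in cover (val D) by rewrite (cover_partition (tl_partition D)) inE.
apply/card_gt0P; exists (pblock (val D) p).
rewrite inE pblock_mem //=; apply/exists_inP; exists p; first by rewrite mem_pblock.
(* Since [pos p] is 0, separating this interval from the left end would need an endpoint of negative
   position. *)
apply/orP; left; apply/forall_inP => a _.
by apply/negP => /exists_inP[q _ /exists_inP[r _]].
Qed.

Lemma left_exposed_leq D : #|left_exposed D| <= n.
Proof. by rewrite -[leqRHS](card_tl_diagram D) subset_leq_card ?left_exposed_sub. Qed.

Lemma card_labellings (d : nat) (X : blobbed_tl_diagram n) :
  #|{ffun {c : {set point n} | c \in components X} -> residue d}| =
  d ^ (n + #|(val X).2|).
Proof. by rewrite card_ffun card_ord card_sig -card_components. Qed.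

Lemma card_abacus_blob (d : nat) :
  #|abacus_blob d n| = d ^ n * \sum_(D : tl_diagram n) (1 + d) ^ #|left_exposed D|.
Proof.
rewrite card_tagged sumnE big_map big_enum /=.
under eq_bigr => X _ do rewrite card_labellings expnD.
rewrite -big_distrr /=; congr (_ * _).
under [RHS]eq_bigr => D _ do rewrite -sum_subset_expn.
rewrite pair_big_dep /=.
(* Blobbed diagrams are exactly the pairs (D, B) of the double sum, [insub] being the partial
   inverse of [val]. *)
rewrite [RHS](reindex_omap (val : blobbed_tl_diagram n -> _) insub) /=.
  by apply: eq_big => // X; rewrite valK eqxx andbT (valP X).
by move=> [D B] sB; rewrite insubT.
Qed.

End Diagram.

Theorem theorem5p9 (d n : nat) (hd : 0 < d) (hn : 0 < n) :
  #|abacus_blob d n| = d ^ n * \sum_(1 <= k < n.+1) chi n k * (1 + d) ^ k.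
Proof.
rewrite card_abacus_blob; congr (_ * _).
under [RHS]eq_bigr => k _ do rewrite /chi -sum_nat_const big_mkcond /=.
(* For a fixed [D], only the index k = [#|left_exposed D|] contributes. *)
rewrite exchange_big /=; apply: eq_bigr => D _.
under eq_bigr => k _ do rewrite inE eq_sym.
rewrite -big_mkcond /= big_nat1_eq.
(* That index lies between 1 and n, so its term does occur in the sum. *)
by rewrite left_exposed_gt0 //= ltnS left_exposed_leq.
Qed.
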